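(* Let $\kappa\in\overline S$ and $\gamma,\mu\in\mathcal D^\sigma$ with $\kappa\in\tau(\gamma)$, $\kappa\in\tau(\mu)$, and $t_\mu(\kappa)\notin\{\mathtt{1r1s},\mathtt{1ic},\mathtt{2ic},\mathtt{3ic}\}$. Choose $\lambda\in\mathcal D^\sigma$ with $\mu\xrightarrow{\kappa}\lambda$. Then $$\sum_{\mu'\,:\,\mu'\xrightarrow{\kappa}\lambda}\widehat P(\gamma,\mu')\,m_\kappa(\mu',\lambda)=\big[\text{coefficient of }\hat a^\kappa_\gamma\text{ in }\widehat T_\kappa\widehat C_\lambda\big]-\widehat U_\kappa(\gamma,\lambda).$$ The sum on the left is over $\mu'\in\{\mu,w_\kappa\times\mu\}$ if $t_\mu(\kappa)\in\{\mathtt{1r2},\mathtt{2r22}\}$, over $\mu'\in\{\mu,s_\alpha\times\mu\}$ (where $\kappa=\{s_\alpha,s_\beta\}$) if $t_\mu(\kappa)=\mathtt{2r21}$, and over just $\mu'=\mu$ otherwise.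
   Context: Setting (Lusztig–Vogan). $G$ is a complex connected reductive group, $\theta$ a Cartan involution, $K=G^\theta$, $H\subset B$ a Cartan and a Borel subgroup, $(W,S)$ the Weyl group with its simple reflections. $\sigma$ is an automorphism of $G$ commuting with $\theta$, preserving $(B,H)$ and inducing an involution $\sigma$ of $(W,S)$. $\mathcal D$ is the finite set of irreducible $K$-equivariant local systems on $K$-orbits on $G/B$, with its length $\ell$, cross action $w\times\gamma$ of $W$, and (possibly multivalued) Cayley transforms $\gamma^\alpha$ (noncompact imaginary $\alpha$), $\gamma_\alpha$ (real parity $\alpha$). $\mathcal D^\sigma$ is the set of $\sigma$-fixed elements. $\overline S$ is the set of $\sigma$-orbits on $S$. For $\kappa=\{s_\alpha\}$ or $\{s_\alpha,s_\beta\}$ ($\beta=\sigma\alpha$), $w_\kappa$ is the longest element of the group generated by $\kappa$ and $\ell(\kappa)=\ell(w_\kappa)$: it is $1$ if $\sigma\alpha=\alpha$, $2$ if $\alpha\neq\beta$ are orthogonal, $3$ if $\langle\alpha,\beta^\vee\rangle=-1$. Types. For $\gamma\in\mathcal D^\sigma$, $\kappa\in\overline S$ the type $t_\gamma(\kappa)$ (leading digit $k=\ell(\kappa)$) is one of: Ascents ($\kappa\notin\tau(\gamma)$): 1C+, 1i1, 1i2f, 1i2s, 1rn; 2C+, 2Ci, 2i11, 2i12, 2i22, 2rn; 3C+, 3Ci, 3i, 3rn. Descents ($\kappa\in\tau(\gamma)$): 1C-, 1r1f, 1r1s, 1r2, 1ic; 2C-, 2Cr, 2r11, 2r21, 2r22,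 2ic; 3C-, 3Cr, 3r, 3ic. $\tau(\gamma)$ is the set of descents. Here C$\pm$: $\alpha$ (and $\beta$) complex, $\pm\theta\alpha>0$, $\theta\alpha\ne\pm\beta$ if $k>1$; Ci: $\theta\alpha=\beta$; Cr: $\theta\alpha=-\beta$; ic: compact imaginary; rn: real not satisfying the parity condition; the remaining i- (resp. r-) types: noncompact imaginary (resp. real parity). 1i1: type 1; 1i2f, 1i2s: type 2 with $\sigma$ fixing, resp. switching, the two values of $\gamma^\alpha$; 1r1f, 1r1s: type 1 with $\sigma$ fixing, resp. switching, the two values of $\gamma_\alpha$; 1r2: type 2; 2i11, 2i12, 2i22: $(\gamma^\alpha)^\beta$ has $1,2,4$ values; 2r22, 2r21, 2r11: $(\gamma_\alpha)_\beta$ has $1,2,4$ values. The $\kappa$-Cayley transforms are: $\gamma^\kappa=\gamma^\alpha$, $\gamma_\kappa=\gamma_\alpha$ for 1i1,1i2f,1r1f,1r2; $\gamma^\kappa=(\gamma^\alpha)^\beta$, $\gamma_\kappa=(\gamma_\alpha)_\beta$ for 2i11,2i12,2r22,2r21, and the two $\sigma$-fixed elements of these sets for 2i22, 2r11; $s_\alpha\times\gamma=s_\beta\times\gamma$ for 2Ci ($\gamma^\kappa$) and 2Cr ($\gamma_\kappa$); $\gamma^\kappa=(s_\alpha\times\gamma)^\beta\cap(s_\beta\times\gamma)^\alpha$ for 3Ci and $\gamma_\kappa=(s_\alpha\times\gamma)_\beta\cap(s_\beta\times\gamma)_\alpha$ for 3Cr; $\gamma^\kappa=s_\alpha\times\gamma^\beta=s_\beta\times\gamma^\alpha$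 for 3i and $\gamma_\kappa=s_\alpha\times\gamma_\beta=s_\beta\times\gamma_\alpha$ for 3r. Two values are denoted $\gamma^\kappa_1,\gamma^\kappa_2$ or $\gamma_\kappa^1,\gamma_\kappa^2$. Up- and down-transforms are mutually inverse relations, matching 1i1/1r1f, 1i2f/1r2, 2Ci/2Cr, 2i11/2r11, 2i12/2r21, 2i22/2r22, 3Ci/3Cr, 3i/3r; in types 1r2, 2r22 the parameters $\gamma\neq w_\kappa\times\gamma$ have the same type and the same $\gamma_\kappa$; $w_\kappa\times$ exchanges $k$C+ and $k$C-. Module. $u=v^2$. $M$ is the Lusztig–Vogan module, free over $\mathbb Z[v,v^{-1}]$ with basis $a_\gamma$ ($\gamma\in\mathcal D^\sigma$), for the Hecke algebra generated by the $T_{w_\kappa}$ with $(T_{w_\kappa}+1)(T_{w_\kappa}-u^{\ell(\kappa)})=0$. Standing assumption: extensions of parameters have been chosen so that, with $k=\ell(\kappa)$, $T_{w_\kappa}a_\gamma$ equals $k$C+: $a_{w_\kappa\times\gamma}$; $k$C-: $(u^k-1)a_\gamma+u^ka_{w_\kappa\times\gamma}$; 1i1, 2i11: $a_{w_\kappa\times\gamma}+a_{\gamma^\kappa}$; 1i2f, 2i22: $a_\gamma+a_{\gamma^\kappa_1}+a_{\gamma^\kappa_2}$; 2i12: $a_\gamma+\sum_{\gamma'\xrightarrow{\kappa}\gamma}\epsilon(\gamma',\gamma)a_{\gamma'}$; 2Ci, 3Ci, 3i: $ua_\gamma+(u+1)a_{\gamma^\kappa}$; 1i2s, 1rn, 2rn,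 3rn: $-a_\gamma$; 1ic, 2ic, 3ic, 1r1s: $u^ka_\gamma$; 1r1f, 2r11: $(u^k-2)a_\gamma+(u^k-1)(a_{\gamma_\kappa^1}+a_{\gamma_\kappa^2})$; 1r2, 2r22: $(u^k-1)a_\gamma-a_{w_\kappa\times\gamma}+(u^k-1)a_{\gamma_\kappa}$; 2r21: $(u^2-2)a_\gamma+(u^2-1)\sum_{\gamma\xrightarrow{\kappa}\gamma'}\epsilon(\gamma,\gamma')a_{\gamma'}$; 2Cr, 3Cr, 3r: $(u^k-u-1)a_\gamma+(u^k-u)a_{\gamma_\kappa}$. Arrows: $\gamma\xrightarrow{\kappa}\lambda$ means $\kappa\in\tau(\gamma)$, $\kappa\notin\tau(\lambda)$ and $a_\lambda$ appears in $T_{w_\kappa}a_\gamma$. Signs: for $\gamma\xrightarrow{\kappa}\lambda$, $\epsilon(\gamma,\lambda)=1$ unless $t_\gamma(\kappa)=$ 2r21; in that case $\gamma$ belongs to an ordered pair $(\gamma_1,\gamma_2)$ with $\{\gamma_1,\gamma_2\}=\{\gamma,s_\alpha\times\gamma\}$, $\lambda$ to an ordered pair $(\lambda_1,\lambda_2)$ of 2i12 parameters whose underlying set is the common Cayley transform of $\gamma_1,\gamma_2$ (chosen orderings), and $\epsilon(\gamma_i,\lambda_j)=-1$ if $i=j=2$ and $1$ otherwise. Defect: $\mathrm{def}_\gamma(\kappa)=1$ if $t_\gamma(\kappa)\in\{$2Ci, 3Ci, 3i, 2Cr, 3Cr, 3r$\}$, else $0$; if $\gamma\xrightarrow{\kappa}\lambda$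 then $\ell(\gamma)-\ell(\lambda)=\ell(\kappa)-\mathrm{def}_\gamma(\kappa)$ and $\mathrm{def}_\lambda(\kappa)=\mathrm{def}_\gamma(\kappa)$. Normalizations: $\hat a_\gamma=v^{-\ell(\gamma)}a_\gamma$, $\widehat T_\kappa=v^{-\ell(\kappa)}(T_{w_\kappa}+1)$, and for $\kappa\in\tau(\gamma)$, $\hat a^\kappa_\gamma=\hat a_\gamma+\sum_{\gamma'\,:\,\gamma\xrightarrow{\kappa}\gamma'}v^{\ell(\gamma')-\ell(\gamma)}\epsilon(\gamma,\gamma')\hat a_{\gamma'}$. For fixed $\kappa$ the $\hat a^\kappa_\gamma$ ($\kappa\in\tau(\gamma)$) are linearly independent and the image of $\widehat T_\kappa$ lies in their span; coefficients of $\hat a^\kappa_\gamma$ refer to this expansion. Canonical basis (Lusztig–Vogan, recalled). $\mathcal D^\sigma$ has a partial order $\le$ with $\gamma<\delta\Rightarrow\ell(\gamma)<\ell(\delta)$. $M$ has a canonical additive involution $\mathbf D$, semilinear for $v\mapsto v^{-1}$, commuting with every $\widehat T_\kappa$, and a unique basis $\widehat C_\delta=\sum_\gamma\widehat P(\gamma,\delta)\hat a_\gamma$ ($\delta\in\mathcal D^\sigma$) with $\mathbf D\widehat C_\delta=\widehat C_\delta$, $\widehat P(\gamma,\delta)\neq0\Rightarrow\gamma\le\delta$, $\widehat P(\delta,\delta)=1$, $\widehat P(\gamma,\delta)\in v^{-1}\mathbb Z[v^{-1}]$ for $\gamma\ne\delta$; moreover $\widehat P(\gamma,\delta)=v^{\ell(\gamma)-\ell(\delta)}P(\gamma,\delta)(v^2)$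 with $P(\gamma,\delta)$ an integer polynomial. Also $\kappa\in\tau(\lambda)$ iff $\widehat T_\kappa\widehat C_\lambda=(v^{\ell(\kappa)}+v^{-\ell(\kappa)})\widehat C_\lambda$. For $\kappa\notin\tau(\lambda)$ there are unique $m_\kappa(\gamma,\lambda)\in\mathbb Z[v,v^{-1}]$, invariant under $v\mapsto v^{-1}$, with $\widehat T_\kappa\widehat C_\lambda=\sum_{\gamma:\kappa\in\tau(\gamma)}m_\kappa(\gamma,\lambda)\widehat C_\gamma$. $\mu_{-1}(\gamma,\delta)$ is the coefficient of $v^{-1}$ in $\widehat P(\gamma,\delta)$. For $\kappa\in\tau(\delta)$, $\kappa\notin\tau(\lambda)$ write $\delta\overset{\kappa}{\prec}\lambda$ if one of the following holds: (b) $\delta<\lambda$; (c) $\mathrm{def}_\delta(\kappa)=1$, $\delta\not<\lambda$ and $\mu_{-1}(\delta_\kappa,\lambda)\ne0$; (c$'$) $\mathrm{def}_\lambda(\kappa)=1$, $\delta\not<\lambda$ and $\mu_{-1}(\delta,\lambda^\kappa)\neq0$. For $\kappa\notin\tau(\lambda)$ set $\widehat U_\kappa(\gamma,\lambda)=\sum_{\delta:\,\kappa\in\tau(\delta),\ \delta\overset{\kappa}{\prec}\lambda}\widehat P(\gamma,\delta)\,m_\kappa(\delta,\lambda)$. *)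

(* Defs.v *)
From HB Require Import structures.
From mathcomp Require Import all_boot all_order all_algebra all_fingroup.
From mathcomp Require Import finmap.
From mathcomp.multinomials Require Import monalg.

Set Implicit Arguments.
Unset Strict Implicit.
Unset Printing Implicit Defensive.

Import Order.TTheory GRing.Theory Num.Theory.
Local Open Scope ring_scope.

(* Z[v, v^-1] as the group ring of the additive group Z: finitely supported
   functions int -> int, x@_k being the coefficient of v^k.  [monalg] only
   supplies the module structure here, since it builds products for monoids
   without nontrivial units. *)
Definition laurent := {malg int[int]}.

HB.instance Definition _ := GRing.Zmodule.on laurent.

Section LaurentRing.
Implicit Types x y z : laurent.

Definition vpow (k : int) : laurent := mkmalgU k 1.

Definition laurent_mul x y : laurent :=
  \sum_(i <- msupp x) \sum_(j <- msupp y) mkmalgU (i + j) (x@_i * y@_j).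

Lemma laurent_mulw (A B : {fset int}) x y :
  fsubset (msupp x) A -> fsubset (msupp y) B ->
  laurent_mul x y =
    \sum_(i <- A) \sum_(j <- B) mkmalgU (i + j) (x@_i * y@_j).
Proof.
move=> leA leB; rewrite /laurent_mul (big_fset_incl _ leA) /=.
  apply/eq_bigr=> i _; apply/big_fset_incl => // j _ /mcoeff_outdom ->.
  by rewrite mulr0 monalgU0.
move=> i _ /mcoeff_outdom xi; rewrite big1 // => j _.
by rewrite xi mul0r monalgU0.
Qed.

Lemma laurent_mulC : commutative laurent_mul.
Proof.
move=> x y; rewrite /laurent_mul exchange_big /=.
by apply/eq_bigr=> i _; apply/eq_bigr=> j _; rewrite addrC mulrC.
Qed.

Lemma laurent_mulDl : left_distributive laurent_mul +%R.
Proof.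
move=> x y z.
rewrite [in RHS](laurent_mulw (fsubsetUl _ (msupp y)) (fsubset_refl _)).
rewrite [in RHS](laurent_mulw (fsubsetUr (msupp x) _) (fsubset_refl _)).
rewrite (laurent_mulw (msuppD_le _ _) (fsubset_refl _)).
rewrite -big_split /=; apply/eq_bigr=> i _.
rewrite -big_split /=; apply/eq_bigr=> j _.
by rewrite mcoeffD mulrDl monalgUD.
Qed.

Lemma laurent_mul0r : left_zero 0 laurent_mul.
Proof. by move=> x; rewrite /laurent_mul msupp0 big_seq_fset0. Qed.

Lemma laurent_mulU (i j a b : int) :
  laurent_mul (mkmalgU i a) (mkmalgU j b) = mkmalgU (i + j) (a * b).
Proof.
by rewrite (laurent_mulw msuppU_le msuppU_le) !big_seq_fset1 !mcoeffUU.
Qed.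

Lemma laurent_mulEl x y :
  laurent_mul x y = \sum_(i <- msupp x) laurent_mul (mkmalgU i x@_i) y.
Proof.
rewrite [in LHS](monalgE x).
exact: (big_morph (laurent_mul^~ y) (fun _ _ => laurent_mulDl _ _ _)
          (laurent_mul0r _)).
Qed.

Lemma laurent_mulEr x y :
  laurent_mul x y = \sum_(j <- msupp y) laurent_mul x (mkmalgU j y@_j).
Proof.
by rewrite laurent_mulC laurent_mulEl; apply/eq_bigr=> j _; apply/laurent_mulC.
Qed.

Lemma laurent_mul1r : left_id (vpow 0) laurent_mul.
Proof.
move=> x; rewrite laurent_mulEr [RHS]monalgE.
by apply/eq_bigr=> j _; rewrite laurent_mulU add0r mul1r.
Qed.

Lemma laurent_mulA : associative laurent_mul.
Proof.
have mulDr x y z :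
    laurent_mul x (y + z) = laurent_mul x y + laurent_mul x z.
  by rewrite (laurent_mulC x) laurent_mulDl (laurent_mulC y) (laurent_mulC z).
have mulr0 x : laurent_mul x 0 = 0 by rewrite laurent_mulC laurent_mul0r.
pose ml z := big_morph (laurent_mul^~ z) (fun _ _ => laurent_mulDl _ _ _)
               (laurent_mul0r z).
pose mr x := big_morph (laurent_mul x) (mulDr x) (mulr0 x).
move=> x y z; rewrite laurent_mulEl [in RHS](laurent_mulEl x y) ml.
apply/eq_bigr=> i _.
rewrite (laurent_mulEl y z) (laurent_mulEr _ y) mr ml.
apply/eq_bigr=> j _; rewrite [in LHS](laurent_mulEr _ z) mr [RHS](laurent_mulEr _ z).
by apply/eq_bigr=> k _; rewrite !laurent_mulU addrA mulrA.
Qed.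

Lemma laurent_oner_neq0 : vpow 0 != 0.
Proof.
by apply/eqP=> /(congr1 (mcoeff 0)); rewrite /vpow mcoeffUU mcoeff0.
Qed.

End LaurentRing.

HB.instance Definition _ := GRing.Zmodule_isComNzRing.Build laurent
  laurent_mulA laurent_mulC laurent_mul1r laurent_mulDl laurent_oner_neq0.

Definition lbar (x : laurent) : laurent :=
  \sum_(i <- msupp x) mkmalgU (- i) x@_i.

Definition u : laurent := vpow 2.

(* The root datum of (G, H), with the base given by B.  Characters of H are
   row vectors, cocharacters column vectors. *)
Record root_datum := RootDatum {
  rk : nat;
  Phi : finType;
  rt : Phi -> 'rV[int]_rk;
  crt : Phi -> 'cV[int]_rk;
  refl : Phi -> {perm Phi};
  sidx : finType;
  simple : sidx -> Phi;
  rt_inj : injective rt;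
  crt_inj : injective crt;
  rt_crt : forall a, (rt a *m crt a) 0 0 = 2;
  rt_refl : forall a b, rt (refl a b) = rt b - (rt b *m crt a) 0 0 *: rt a;
  crt_refl : forall a b, crt (refl a b) = crt b - (rt a *m crt b) 0 0 *: crt a;
  rt_reduced : forall a b, rt a != rt b *+ 2;
  simple_free : forall c : sidx -> int,
    \sum_i c i *: rt (simple i) = 0 -> forall i, c i = 0;
  simple_base : forall a, exists c : sidx -> nat,
    rt a = \sum_i rt (simple i) *+ c i \/ rt a = - \sum_i rt (simple i) *+ c i
}.

Section RootDatum.
Variable RD : root_datum.
Implicit Types (a : Phi RD) (w : {perm Phi RD}).

Definition pos_root a : Prop :=
  exists c : sidx RD -> nat, rt a = \sum_i rt (simple i) *+ c i.

(* s_a(a) = - a *)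
Definition opp_root a : Phi RD := refl a a.

Definition srefl (i : sidx RD) : {perm Phi RD} := refl (simple i).

Definition weyl : {group {perm Phi RD}} := <<[set srefl i | i : sidx RD]>>%G.

(* Word length in the simple reflections; reduced words of elements of [weyl]
   are shorter than #|weyl|. *)
Definition wlen w : nat :=
  find (fun n => [exists s : n.-tuple (sidx RD), \prod_(i <- s) srefl i == w]%g)
       (iota 0 #|weyl|).

(* p is the permutation of the roots induced by the automorphism x |-> x A of
   the root datum *)
Definition root_aut (A : 'M[int]_(rk RD)) (p : {perm Phi RD}) : Prop :=
  A \in unitmx /\
  forall a, rt (p a) = rt a *m A /\ A *m crt (p a) = crt a.

End RootDatum.

Inductive lvtype :=
  | t1Cp | t1i1 | t1i2f | t1i2s | t1rn
  | t2Cp | t2Ci | t2i11 | t2i12 | t2i22 | t2rn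
  | t3Cp | t3Ci | t3i | t3rn
  | t1Cm | t1r1f | t1r1s | t1r2 | t1ic
  | t2Cm | t2Cr | t2r11 | t2r21 | t2r22 | t2ic
  | t3Cm | t3Cr | t3r | t3ic.

Definition is_descent (t : lvtype) : bool :=
  match t with
  | t1Cp | t1i1 | t1i2f | t1i2s | t1rn
  | t2Cp | t2Ci | t2i11 | t2i12 | t2i22 | t2rn
  | t3Cp | t3Ci | t3i | t3rn => false
  | _ => true
  end.

Definition leading_digit (t : lvtype) : nat :=
  match t with
  | t1Cp | t1i1 | t1i2f | t1i2s | t1rn
  | t1Cm | t1r1f | t1r1s | t1r2 | t1ic => 1
  | t2Cp | t2Ci | t2i11 | t2i12 | t2i22 | t2rn
  | t2Cm | t2Cr | t2r11 | t2r21 | t2r22 | t2ic => 2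
  | _ => 3
  end.

Definition has_defect (t : lvtype) : bool :=
  match t with
  | t2Ci | t3Ci | t3i | t2Cr | t3Cr | t3r => true
  | _ => false
  end.

Definition cayley_partner (t : lvtype) : option lvtype :=
  match t with
  | t1i1 => Some t1r1f | t1i2f => Some t1r2
  | t2Ci => Some t2Cr  | t2i11 => Some t2r11
  | t2i12 => Some t2r21 | t2i22 => Some t2r22
  | t3Ci => Some t3Cr  | t3i => Some t3r
  | _ => None
  end.

(* Number of elements of the up- or down- kappa-Cayley transform. *)
Definition cayley_card (t : lvtype) : nat :=
  match t with
  | t1i1 | t2i11 | t2Ci | t3Ci | t3i
  | t1r2 | t2r22 | t2Cr | t3Cr | t3r => 1
  | t1i2f | t2i12 | t2i22 | t1r1f | t2r11 | t2r21 => 2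
  | _ => 0
  end.

(* The combinatorial data carried by the K-equivariant local systems.  The
   reductive group itself is not formalized: [param] is an abstract finite set,
   [ptheta g] is the involution of the roots attached to g, [noncpt] and
   [parity] are only meaningful for imaginary, resp. real, simple roots.
   Permutations compose as [(s * t) x = t (s x)], so that mathcomp actions of
   [weyl] are left actions for composition of reflections. *)
Record lv_data := LVData {
  rdat :> root_datum;
  sigR : {perm Phi rdat};
  sigS : {perm sidx rdat};
  sigR_aut : exists A, root_aut A sigR;
  sigR_simple : forall i, sigR (simple i) = simple (sigS i);
  sigS_invol : involutive sigS;

  param : finType;
  plen : param -> nat;
  ptheta : param -> {perm Phi rdat};
  noncpt : param -> sidx rdat -> bool;
  parity : param -> sidx rdat -> bool;
  cross : action (weyl rdat) param;
  cayup : param -> sidx rdat -> {set param};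
  caydn : param -> sidx rdat -> {set param};
  sigD : {perm param};

  ptheta_aut : forall g, exists A, A *m A = 1%:M /\ root_aut A (ptheta g);
  ptheta_cross : forall g w, w \in weyl rdat ->
    ptheta (cross g w) = (ptheta g ^ w)%g;
  cayupP : forall g d i, d \in cayup g i ->
    [/\ ptheta g (simple i) = simple i, noncpt g i & g \in caydn d i];
  caydnP : forall g d i, d \in caydn g i ->
    [/\ ptheta g (simple i) = opp_root (simple i), parity g i
      & g \in cayup d i];

  sig_len : forall g, plen (sigD g) = plen g;
  sig_theta : forall g, ptheta (sigD g) = (ptheta g ^ sigR)%g;
  sig_noncpt : forall g i, noncpt (sigD g) (sigS i) = noncpt g i;
  sig_parity : forall g i, parity (sigD g) (sigS i) = parity g i;
  sig_cross : forall g w, w \in weyl rdat ->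
    sigD (cross g w) = cross (sigD g) (w ^ sigR)%g;
  sig_cayup : forall g i, cayup (sigD g) (sigS i) = sigD @: cayup g i;
  sig_caydn : forall g i, caydn (sigD g) (sigS i) = sigD @: caydn g i
}.

Section Types.
Variable X : lv_data.
Implicit Types (g d : param X) (i j : sidx X).

(* The set of sigma-orbits on S. *)
Definition Sbar := {k : {set sidx X} | k \in porbits (sigS X)}.

(* The sigma-fixed parameters. *)
Definition Dsig := {g : param X | sigD X g == g}.

Implicit Types (k : Sbar) (gam del : Dsig).

Definition wk k : {perm Phi X} :=
  [arg max_(w > 1%g in <<[set srefl i | i in val k]>>%g) wlen w].

Definition ell k : nat := wlen (wk k).

Definition scross i g : param X := cross X g (srefl i).

Definition nci g i : Prop := ptheta g (simple i) = simple i /\ noncpt g i.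
Definition cpt g i : Prop := ptheta g (simple i) = simple i /\ ~~ noncpt g i.
Definition rpar g i : Prop :=
  ptheta g (simple i) = opp_root (simple i) /\ parity g i.
Definition rnpar g i : Prop :=
  ptheta g (simple i) = opp_root (simple i) /\ ~~ parity g i.

Definition cayup2 g i j : {set param X} := \bigcup_(d in cayup g i) cayup d j.
Definition caydn2 g i j : {set param X} := \bigcup_(d in caydn g i) caydn d j.

(* alpha and beta = sigma alpha are the simple roots of index i and j. *)
Definition type_cond (t : lvtype) g i j : Prop :=
  let th := ptheta g in
  let al := simple i in
  let be := simple j in
  let complex := [/\ th al <> al, th al <> opp_root al
                   & (1 < leading_digit t)%N ->
                     th al <> be /\ th al <> opp_root be] in
  match t with
  | t1Cp | t2Cp | t3Cp => complex /\ pos_root (th al)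
  | t1Cm | t2Cm | t3Cm => complex /\ pos_root (opp_root (th al))
  | t2Ci | t3Ci => th al = be
  | t2Cr | t3Cr => th al = opp_root be
  | t1ic | t2ic | t3ic => cpt g i
  | t1rn | t2rn | t3rn => rnpar g i
  | t1i1 => nci g i /\ #|cayup g i| = 1
  | t1i2f => [/\ nci g i, #|cayup g i| = 2
               & forall d, d \in cayup g i -> sigD X d = d]
  | t1i2s => [/\ nci g i, #|cayup g i| = 2
               & forall d, d \in cayup g i ->
                   sigD X d \in cayup g i /\ sigD X d <> d]
  | t1r1f => [/\ rpar g i, #|caydn g i| = 2
               & forall d, d \in caydn g i -> sigD X d = d]
  | t1r1s => [/\ rpar g i, #|caydn g i| = 2
               & forall d, d \in caydn g i ->
                   sigD X d \in caydn g i /\ sigD X d <> d]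
  | t1r2 => rpar g i /\ #|caydn g i| = 1
  | t2i11 => nci g i /\ #|cayup2 g i j| = 1
  | t2i12 => nci g i /\ #|cayup2 g i j| = 2
  | t2i22 => nci g i /\ #|cayup2 g i j| = 4
  | t2r22 => rpar g i /\ #|caydn2 g i j| = 1
  | t2r21 => rpar g i /\ #|caydn2 g i j| = 2
  | t2r11 => rpar g i /\ #|caydn2 g i j| = 4
  | t3i => nci g i
  | t3r => rpar g i
  end.

Definition type_spec (t : lvtype) (g : param X) k : Prop :=
  ell k = leading_digit t /\
  forall i, i \in val k -> type_cond t g i (sigS X i).

Definition cayup_at (t : lvtype) g i j : {set param X} :=
  match t with
  | t1i1 | t1i2f => cayup g i
  | t2i11 | t2i12 | t2i22 => cayup2 g i j
  | t2Ci => [set scross i g]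
  | t3Ci => cayup (scross i g) j :&: cayup (scross j g) i
  | t3i => [set scross i d | d in cayup g j]
  | _ => set0
  end.

Definition caydn_at (t : lvtype) g i j : {set param X} :=
  match t with
  | t1r1f | t1r2 => caydn g i
  | t2r11 | t2r21 | t2r22 => caydn2 g i j
  | t2Cr => [set scross i g]
  | t3Cr => caydn (scross i g) j :&: caydn (scross j g) i
  | t3r => [set scross i d | d in caydn g j]
  | _ => set0
  end.

(* The sigma-fixed elements of the transforms above.  These transforms do not
   depend on which root of the orbit is called alpha; requiring membership for
   both choices avoids selecting one. *)
Definition kup_of (t : lvtype) k gam : {set Dsig} :=
  [set del : Dsig | [forall i in val k,
                       val del \in cayup_at t (val gam) i (sigS X i)]].

Definition kdn_of (t : lvtype) k gam : {set Dsig} :=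
  [set del : Dsig | [forall i in val k,
                       val del \in caydn_at t (val gam) i (sigS X i)]].

End Types.

(* The types t_gamma(kappa) and the recalled properties of the kappa-Cayley
   transforms and of w_kappa x. *)
Record lv_params := LVParams {
  ldat :> lv_data;
  ty : Dsig ldat -> Sbar ldat -> lvtype;
  tyP : forall g k, type_spec (ty g k) (val g) k;
  wcross_fix : forall k (g : Dsig ldat),
    sigD ldat (cross ldat (val g) (wk k)) == cross ldat (val g) (wk k);
  kup_card : forall k g, ~~ is_descent (ty g k) ->
    #|kup_of (ty g k) k g| = cayley_card (ty g k);
  kdn_card : forall k g, is_descent (ty g k) ->
    #|kdn_of (ty g k) k g| = cayley_card (ty g k);
  cayley_inverse : forall k g d t t', cayley_partner t = Some t' ->
    ty g k = t /\ d \in kup_of t k g <-> ty d k = t' /\ g \in kdn_of t' k d;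
  wcross_C : forall k (g d : Dsig ldat),
    val d = cross ldat (val g) (wk k) ->
    match ty g k with
    | t1Cp => ty d k = t1Cm | t2Cp => ty d k = t2Cm | t3Cp => ty d k = t3Cm
    | t1Cm => ty d k = t1Cp | t2Cm => ty d k = t2Cp | t3Cm => ty d k = t3Cp
    | t1r2 | t2r22 =>
        [/\ d <> g, ty d k = ty g k
          & kdn_of (ty d k) k d = kdn_of (ty g k) k g]
    | _ => True
    end
}.

Section Module.
Variable P : lv_params.
Local Notation D := (Dsig P).
Local Notation S := (Sbar P).
Implicit Types (k : S) (g d : D).

Definition tau_mem k g : bool := is_descent (ty g k).
Definition def_at k g : bool := has_defect (ty g k).
Definition kup k g : {set D} := kup_of (ty g k) k g.
Definition kdn k g : {set D} := kdn_of (ty g k) k g.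
Definition wcross k g : D := exist (fun x => sigD P x == x) _ (wcross_fix k g).

Definition lvM := {ffun D -> laurent^o}.
Definition abas g : lvM := [ffun d => (d == g)%:R].
Definition ahat g : lvM := vpow (- (plen (val g))%:Z) *: abas g.

(* [rp k g] and [ip k l] are the chosen ordered pairs containing g (of type
   2r21), resp. l (of type 2i12). *)
Definition epsilon (rp ip : S -> D -> D * D) k g l : laurent :=
  match ty g k with
  | t2r21 => if (g == (rp k g).2) && (l == (ip k l).2) then -1 else 1
  | _ => 1
  end.

Definition T_formula (rp ip : S -> D -> D * D) k g : lvM :=
  let a := abas in
  let n := ell k in
  let w := wcross k g in
  let eps := epsilon rp ip k in
  match ty g k with
  | t1Cp | t2Cp | t3Cp => a w
  | t1Cm | t2Cm | t3Cm => (u ^+ n - 1) *: a g + u ^+ n *: a w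
  | t1i1 | t2i11 => a w + \sum_(d in kup k g) a d
  | t1i2f | t2i22 => a g + \sum_(d in kup k g) a d
  | t2i12 => a g + \sum_(d in kup k g) eps d g *: a d
  | t2Ci | t3Ci | t3i => u *: a g + (u + 1) *: \sum_(d in kup k g) a d
  | t1i2s | t1rn | t2rn | t3rn => - a g
  | t1ic | t2ic | t3ic | t1r1s => u ^+ n *: a g
  | t1r1f | t2r11 =>
      (u ^+ n - 2) *: a g + (u ^+ n - 1) *: \sum_(d in kdn k g) a d
  | t1r2 | t2r22 =>
      (u ^+ n - 1) *: a g - a w + (u ^+ n - 1) *: \sum_(d in kdn k g) a d
  | t2r21 =>
      (u ^+ 2 - 2) *: a g + (u ^+ 2 - 1) *: \sum_(d in kdn k g) eps g d *: a d
  | t2Cr | t3Cr | t3r =>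
      (u ^+ n - u - 1) *: a g + (u ^+ n - u) *: \sum_(d in kdn k g) a d
  end.

Definition arrow_for (T : S -> lvM -> lvM) k g l : bool :=
  [&& tau_mem k g, ~~ tau_mem k l & T k (abas g) l != 0].

Definition That_for (T : S -> lvM -> lvM) k (x : lvM) : lvM :=
  vpow (- (ell k)%:Z) *: (T k x + x).

Definition akhat_for (T : S -> lvM -> lvM) (rp ip : S -> D -> D * D) k g : lvM :=
  ahat g + \sum_(d | arrow_for T k g d)
    (vpow ((plen (val d))%:Z - (plen (val g))%:Z) * epsilon rp ip k g d)
      *: ahat d.

(* f (g (f ...)), n factors *)
Fixpoint alternate (n : nat) (f h : lvM -> lvM) (x : lvM) : lvM :=
  if n is n'.+1 then f (alternate n' h f x) else x.

Record lv_module := LVModule {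
  Tk : S -> {linear lvM -> lvM};
  rpair : S -> D -> D * D;
  ipair : S -> D -> D * D;
  rpairP : forall k g i, ty g k = t2r21 -> i \in val k ->
    let p := rpair k g in
    [/\ [set val p.1; val p.2] = [set val g; scross i (val g)],
        p.1 <> p.2,
        rpair k p.1 = p /\ rpair k p.2 = p,
        ty p.1 k = t2r21 /\ ty p.2 k = t2r21
      & kdn k p.1 = kdn k p.2];
  ipairP : forall k g l, ty g k = t2r21 -> l \in kdn k g ->
    let q := ipair k l in
    [/\ [set q.1; q.2] = kdn k g, ipair k q.1 = q & ipair k q.2 = q];
  T_basis : forall k g, Tk k (abas g) = T_formula rpair ipair k g;
  T_quadratic : forall k x,
    let y := Tk k x - u ^+ ell k *: x in Tk k y + y = 0;
  T_braid : forall k k' x, let n := #[wk k * wk k']%g in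
    alternate n (Tk k) (Tk k') x = alternate n (Tk k') (Tk k) x;
  arrow_len : forall k g l, arrow_for Tk k g l ->
    (plen (val g))%:Z - (plen (val l))%:Z = (ell k)%:Z - (def_at k g)%:Z /\
    def_at k l = def_at k g;
  That_span : forall k x, exists c : {ffun D -> laurent},
    That_for Tk k x == \sum_(g | tau_mem k g) c g *: akhat_for Tk rpair ipair k g
}.

Section ModuleTheory.
Variable Md : lv_module.

Definition arrow k g l : bool := arrow_for (Tk Md) k g l.
Definition That k (x : lvM) : lvM := That_for (Tk Md) k x.
Definition eps k g l : laurent := epsilon (rpair Md) (ipair Md) k g l.
Definition akhat k g : lvM := akhat_for (Tk Md) (rpair Md) (ipair Md) k g.

(* For kappa in tau(g), the coefficient of [akhat k g] in [That k x]; it is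
   well defined because the [akhat k g], kappa in tau(g), are independent. *)
Definition akcoef k (x : lvM) g : laurent := xchoose (That_span Md k x) g.

(* The canonical basis. *)
Record lv_canonical := LVCanonical {
  ple : rel D;
  ple_refl : reflexive ple;
  ple_anti : antisymmetric ple;
  ple_trans : transitive ple;
  plt_len : forall g d, ple g d -> g <> d -> (plen (val g) < plen (val d))%N;

  Dbar : lvM -> lvM;
  Dbar_add : forall x y, Dbar (x + y) = Dbar x + Dbar y;
  Dbar_semilinear : forall c x, Dbar (c *: x) = lbar c *: Dbar x;
  Dbar_invol : involutive Dbar;
  Dbar_That : forall k x, Dbar (That k x) = That k (Dbar x);

  Chat : D -> lvM;
  Phat : D -> D -> laurent;
  Ppol : D -> D -> {poly int};
  Chat_Phat : forall d, Chat d = \sum_g Phat g d *: ahat g;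
  Chat_basis : forall x, exists! c : {ffun D -> laurent},
    x = \sum_d c d *: Chat d;
  Dbar_Chat : forall d, Dbar (Chat d) = Chat d;
  Phat_le : forall g d, Phat g d <> 0 -> ple g d;
  Phat_diag : forall d, Phat d d = 1;
  Phat_neg : forall g d (n : int), g <> d -> 0 <= n -> (Phat g d)@_n = 0;
  Phat_Ppol : forall g d, Phat g d =
    vpow ((plen (val g))%:Z - (plen (val d))%:Z)
      * (map_poly (fun n : int => n%:~R : laurent) (Ppol g d)).[u];
  tau_Chat : forall k l, tau_mem k l <->
    That k (Chat l) = (vpow (ell k)%:Z + vpow (- (ell k)%:Z)) *: Chat l;

  mk : S -> D -> D -> laurent;
  mk_bar : forall k g l, tau_mem k g -> ~~ tau_mem k l ->
    lbar (mk k g l) = mk k g l;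
  That_Chat : forall k l, ~~ tau_mem k l ->
    That k (Chat l) = \sum_(g | tau_mem k g) mk k g l *: Chat g
}.

Variable C : lv_canonical.

Definition plt g d : bool := ple C g d && (g != d).

Definition mu1 g d : int := (Phat C g d)@_(-1).

(* Intended for kappa in tau(d), kappa not in tau(l).  When [def_at] is 1 the
   set [kdn k d], resp. [kup k l], has a single element. *)
Definition prec k d l : bool :=
  [|| plt d l,
      [&& def_at k d, ~~ plt d l & [exists d' in kdn k d, mu1 d' l != 0]]
    | [&& def_at k l, ~~ plt d l & [exists l' in kup k l, mu1 d l' != 0]]].

Definition Uhat k g l : laurent :=
  \sum_(d | tau_mem k d && prec k d l) Phat C g d * mk C k d l.

End ModuleTheory.
End Module.

(* Main.v *)
Require Import Defs.
From HB Require Import structures.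
From mathcomp Require Import all_boot all_order all_algebra all_fingroup.
From mathcomp Require Import finmap zify ring.
From mathcomp.multinomials Require Import monalg.

Set Implicit Arguments.
Unset Strict Implicit.
Unset Printing Implicit Defensive.

Import Order.TTheory GRing.Theory Num.Theory.
Local Open Scope ring_scope.

(** Fix kappa, and write d, e for parameters with kappa a descent and l for one
    with kappa an ascent.

    An arrow always points to an ascent, so [akhat k g] is [ahat g] plus a
    combination of ascents. Hence the coefficient of [akhat k g] in an element
    of the image of That is its coefficient on [ahat g] ([akcoefE]), and for
    That C_l it equals the sum of P(g,d) m(d,l) over all descents d
    ([That_Chat_mk]). The sum defining U(g,l) runs over the d that precede l,
    so the formula of the theorem follows from two facts:

    - an arrow d -> l excludes that d precedes l ([arrow_not_prec]): the arrow
      makes d longer than l, and in the two defect conditions the Cayley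
      transform is l, resp. d, itself, while P(l,l) = P(d,d) = 1 has no v^-1
      term;
    - m(d,l) = 0 when there is no arrow d -> l and d does not precede l
      ([mk_degree]).

    For the second point the coefficient of [ahat d] in That C_l is computed in
    two ways. Expanding C_l in the [ahat g] gives a sum of terms P(g,l) c(d,g),
    where c(d,g) is the coefficient of [ahat d] in That [ahat g]; for g other
    than d this coefficient has degree at most 0, except along an arrow d -> g
    of defect 1, where it is v + v^-1 ([hatcoef_cases]). Expanding That C_l in
    the canonical basis gives m(d,l) plus the sum of the P(d,e) m(e,l) with
    e > d. When d is not below l neither is any such e, so downward induction on
    the length bounds the degrees of these m(e,l) as well. Off the diagonal
    every P has negative degree, so for d without arrow to l and not preceding l
    everything except m(d,l) lies in v^-1 Z[v^-1]: the only terms v^0 that could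
    arise are the coefficients of v^-1 which the two defect conditions test.
    Then m(d,l), being invariant under v -> v^-1, vanishes.

    Two facts on the action on the basis are extracted from the quadratic
    relation: w_kappa x is an involution on complex ascents
    ([wcross_wcross_Cplus]), and it maps parameters of types 1i1 and 2i11 to
    ascents ([wcross_type1_ascent]). *)

(** * Degrees of Laurent polynomials *)

Section Laurent.
Implicit Types (x y : laurent) (a b n : int).

Lemma mcoeff_mul x y n : (x * y)@_n = \sum_(i <- msupp x) x@_i * y@_(n - i).
Proof.
rewrite -[x * y]/(laurent_mul x y) /laurent_mul raddf_sum /=.
apply: eq_bigr => i _; rewrite raddf_sum /=.
rewrite (eq_bigr (fun j => if j == n - i then x@_i * y@_j else 0)); last first.
  move=> j _; rewrite mcoeffU; have -> : (i + j == n) = (j == n - i) by lia.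
  by case: eqP.
rewrite -big_mkcond /=.
case: (boolP (n - i \in msupp y)) => [ys|ns].
  by rewrite -big_filter filter_pred1_uniq ?fset_uniq ?big_seq1.
rewrite (mcoeff_outdom ns) mulr0 big_seq_cond big1 // => j /andP[js /eqP e].
by rewrite -e js in ns.
Qed.

Lemma vpowM k l : vpow k * vpow l = vpow (k + l).
Proof. by rewrite -[LHS]/(laurent_mul _ _) laurent_mulU mulr1. Qed.

Lemma vpow0 : vpow 0 = 1. Proof. by []. Qed.

Lemma uX (n : nat) : u ^+ n = vpow (2 * n%:Z).
Proof.
elim: n => [|n IH]; first by rewrite expr0 mulr0.
by rewrite exprS IH /u vpowM; congr vpow; lia.
Qed.

Lemma mcoeff_vpow k n : (vpow k)@_n = (k == n)%:R.
Proof. by rewrite /vpow mcoeffU. Qed.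

Lemma mcoeff_one n : (1 : laurent)@_n = (n == 0)%:R.
Proof. by rewrite -vpow0 mcoeff_vpow eq_sym. Qed.

Definition degle a x := forall n, a < n -> x@_n = 0.

Lemma degle0 a : degle a 0.
Proof. by move=> n _; rewrite mcoeff0. Qed.

Lemma degle_mono a b x : a <= b -> degle a x -> degle b x.
Proof. by move=> leab dx n /(le_lt_trans leab)/dx. Qed.

Lemma degleN a x : degle a x -> degle a (- x).
Proof. by move=> dx n /dx; rewrite mcoeffN => ->; rewrite oppr0. Qed.

Lemma degleD a x y : degle a x -> degle a y -> degle a (x + y).
Proof. by move=> dx dy n an; rewrite mcoeffD dx ?dy. Qed.

Lemma degle_sum a (I : finType) (Q : pred I) (F : I -> laurent) :
  (forall i, Q i -> degle a (F i)) -> degle a (\sum_(i | Q i) F i).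
Proof.
by move=> dF; apply: big_ind => //; [apply: degle0 | apply: degleD].
Qed.

Lemma degle_vpow a k : k <= a -> degle a (vpow k).
Proof.
by move=> ka n an; rewrite mcoeff_vpow; case: eqP => // e; lia.
Qed.

Lemma degleM a b x y : degle a x -> degle b y -> degle (a + b) (x * y).
Proof.
move=> dx dy n abn; rewrite mcoeff_mul big1_seq // => i _.
case: (ltP a i) => ia; first by rewrite dx ?mul0r.
by rewrite dy ?mulr0 //; lia.
Qed.

Lemma degle_pred a x : degle a x -> x@_a = 0 -> degle (a - 1) x.
Proof.
move=> dx xa n an; have [<- //|na] := eqVneq a n.
by apply: dx; lia.
Qed.

Lemma mcoeff_lbar x n : (lbar x)@_n = x@_(- n).
Proof.
rewrite /lbar raddf_sum /=.
rewrite (eq_bigr (fun i => if i == - n then x@_i else 0)); last first.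
  move=> i _; rewrite mcoeffU; have -> : (- i == n) = (i == - n) by lia.
  by case: eqP.
rewrite -big_mkcond /=.
case: (boolP (- n \in msupp x)) => [xs|ns].
  by rewrite -big_filter filter_pred1_uniq ?fset_uniq ?big_seq1.
rewrite (mcoeff_outdom ns) big_seq_cond big1 // => j /andP[js /eqP e].
by rewrite -e js in ns.
Qed.

(** Invariance under v -> v^-1 makes the bound symmetric, so a negative bound on
    the degree leaves no coefficient at all. *)
Lemma lbar_degle_eq0 x : lbar x = x -> degle (-1) x -> x = 0.
Proof.
move=> xb dx; apply/malgP => n; rewrite mcoeff0.
case: (ltP (-1) n) => hn; first exact: dx.
by rewrite -xb mcoeff_lbar dx //; lia.
Qed.

Lemma vpow_subr_neq0 k l : k != l -> vpow k - vpow l != 0.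
Proof.
move=> kl; apply/eqP => /(congr1 (mcoeff k)).
by rewrite mcoeffB mcoeff0 !mcoeff_vpow eqxx eq_sym (negPf kl).
Qed.

Lemma uX_neq0 (n : nat) : u ^+ n != 0.
Proof.
rewrite uX; apply/eqP => /(congr1 (mcoeff (2 * n%:Z))).
by rewrite mcoeff_vpow eqxx mcoeff0.
Qed.

Lemma natr_laurent_neq0 (n : nat) : (n.+1%:R : laurent) != 0.
Proof.
apply/eqP => /(congr1 (mcoeff 0)).
by rewrite mcoeffMn mcoeff_one eqxx mcoeff0 => /eqP; rewrite mulrn_eq0 oner_eq0.
Qed.
End Laurent.

(** * Auxiliary algebra *)

Lemma linear_quadratic (R : nzRingType) (V : lmodType R)
    (f : {linear V -> V}) (c : R) (x : V) :
  f (f x - c *: x) + (f x - c *: x) = 0 -> f (f x) = (c - 1) *: f x + c *: x.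
Proof.
rewrite linearB linearZ /= => /eqP; rewrite addrA.
move: (f (f x)) => y; have -> : y - c *: f x + f x - c *: x
    = y - ((c - 1) *: f x + c *: x).
  by rewrite scalerBl scale1r !opprD opprK !addrA.
by rewrite subr_eq0 => /eqP.
Qed.

(** With x = u^n, the hypotheses of the next two lemmas are what the component on
    a_h of the quadratic relation at a_g becomes when g has type 1i1 or 2i11, h is
    its Cayley transform and the cross action moves g to a descent, different
    from h in the first lemma and equal to h in the second. *)
Lemma type1_square_eq1 (R : comNzRingType) (x c : R) :
  c + (x - 2) = (x - 1) * (0 + 1) -> c = 1.
Proof. by move=> e; apply: (addIr (x - 2)); rewrite e; ring. Qed.

Lemma type1_square_eq2 (R : comNzRingType) (x : R) :
  x - 2 + (x - 2) = (x - 1) * (1 + 1) -> 2%:R = 0 :> R.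
Proof.
move=> e; have -> : 2%:R = (x - 1) * (1 + 1) - (x - 2 + (x - 2)) by ring.
by rewrite e subrr.
Qed.

Lemma mulr_sign_neq0 (R : nzRingType) (x s : R) :
  x != 0 -> s = 1 \/ s = -1 -> x * s != 0.
Proof. by move=> x0 [] ->; rewrite ?mulr1 ?mulrN1 ?oppr_eq0. Qed.

Lemma mulr_bool_neq0 (R : nzRingType) (x : R) (b : bool) :
  x != 0 -> (x * b%:R != 0) = b.
Proof. by move=> x0; case: b; rewrite ?mulr1 ?mulr0 ?eqxx. Qed.

Lemma mulr_shuffle (R : comNzRingType) (a b c p x : R) :
  a * (p * b * c * x) = p * (a * b * c * x).
Proof. by ring. Qed.

Lemma set2_of_card2 (T : finType) (A : {set T}) (x y : T) :
  #|A| = 2%N -> x \in A -> y \in A -> x <> y -> A = [set x; y].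
Proof.
move=> cA xA yA /eqP xy; apply/esym/eqP.
by rewrite eqEcard subUset !sub1set xA yA cards2 xy cA.
Qed.

(** * Cayley transforms and the action on the basis *)

(** On ascents, T_{w_kappa} a_g is a combination of a_g, of a_{w x g} and of the
    signed sum of the Cayley transform of g, with coefficients [up_diag],
    [up_cross] and [up_cayley]; [dn_diag], [dn_cross] and [dn_cayley] do the same
    on descents. This replaces the table of types by two formulas. *)
Definition up_diag (t : lvtype) : laurent :=
  match t with
  | t1i2f | t2i22 | t2i12 => 1
  | t2Ci | t3Ci | t3i => u
  | t1i2s | t1rn | t2rn | t3rn => -1
  | _ => 0
  end.

Definition up_cross (t : lvtype) : laurent :=
  match t with t1Cp | t2Cp | t3Cp | t1i1 | t2i11 => 1 | _ => 0 end.

Definition up_cayley (t : lvtype) : laurent := if has_defect t then u + 1 else 1.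

Definition dn_diag (t : lvtype) : laurent :=
  let n := leading_digit t in
  match t with
  | t1ic | t2ic | t3ic | t1r1s => u ^+ n
  | t1r1f | t2r11 | t2r21 => u ^+ n - 2
  | t2Cr | t3Cr | t3r => u ^+ n - u - 1
  | _ => u ^+ n - 1
  end.

Definition dn_cross (t : lvtype) : laurent :=
  match t with
  | t1Cm | t2Cm | t3Cm => u ^+ leading_digit t
  | t1r2 | t2r22 => -1
  | _ => 0
  end.

Definition dn_cayley (t : lvtype) : laurent :=
  u ^+ leading_digit t - (if has_defect t then u else 1).

Definition is_Cminus (t : lvtype) : bool :=
  match t with t1Cm | t2Cm | t3Cm => true | _ => false end.

Definition is_type2_real (t : lvtype) : bool :=
  match t with t1r2 | t2r22 => true | _ => false end.

Definition is_Cplus (t : lvtype) : bool :=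
  match t with t1Cp | t2Cp | t3Cp => true | _ => false end.

Definition is_type1_imaginary (t : lvtype) : bool :=
  match t with t1i1 | t2i11 => true | _ => false end.

Lemma dn_cayley_neq0 t : dn_cayley t != 0.
Proof.
rewrite /dn_cayley uX.
have -> : (if has_defect t then u else 1) = vpow (if has_defect t then 2 else 0).
  by case: (has_defect t).
by apply: vpow_subr_neq0; case: t.
Qed.

Section Cayley.
Variables (P : lv_params) (Md : lv_module P) (k : Sbar P).
Implicit Types (g d e : Dsig P).

Local Notation t g := (ty g k).
Local Notation w := (wcross k).
Local Notation T := (Tk Md k).

Lemma ell_leading g : ell k = leading_digit (t g).
Proof. by case: (tyP g k). Qed.

Lemma ell_gt_def g : (def_at k g < ell k)%N.
Proof. by rewrite (ell_leading g) /def_at; case: (t g). Qed.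

Lemma wcross_inj : injective w.
Proof.
move=> g d /(congr1 val) /= e; apply: val_inj.
exact: act_inj e.
Qed.

Lemma kup_nonempty_card g d : d \in kup k g -> (0 < #|kup k g|)%N.
Proof. by move=> dg; apply/card_gt0P; exists d. Qed.

(** Up- and down-transforms are inverse relations between ascents and descents;
    a nonempty transform forces the type to have a Cayley partner. *)
Lemma kupP g d : ~~ tau_mem k g -> d \in kup k g ->
  [/\ tau_mem k d, cayley_partner (t g) = Some (t d) & g \in kdn k d].
Proof.
rewrite /tau_mem => ng dg.
have := kup_nonempty_card dg; rewrite /kup (kup_card ng) => cg.
have [t' et'] : exists t', cayley_partner (t g) = Some t'.
  by move: ng cg; case: (t g) => //= _ _; eexists.
have [tp gd] := (cayley_inverse k g d et').1 (conj erefl dg).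
rewrite /kdn tp; split=> //.
by move: et' ng; case: (t g) => //= -[<-].
Qed.

Lemma kdnP g d : tau_mem k d -> g \in kdn k d ->
  [/\ ~~ tau_mem k g, cayley_partner (t g) = Some (t d) & d \in kup k g].
Proof.
rewrite /tau_mem => nd gd.
have cd : (0 < cayley_card (t d))%N.
  by rewrite -kdn_card //; apply/card_gt0P; exists g.
have [t' et'] : exists t', cayley_partner t' = Some (t d).
  move: nd cd; case: (t d) => //= _ _;
  by [exists t1i1 | exists t1i2f | exists t2Ci | exists t2i11 | exists t2i12
     | exists t2i22 | exists t3Ci | exists t3i].
have [tp dg] := (cayley_inverse k g d et').2 (conj erefl gd).
rewrite /kup tp; split=> //.
by move: et'; case: (t') => //=.
Qed.

Lemma kdn_type2_real d : is_type2_real (t d) ->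
  [/\ w d <> d, t (w d) = t d & kdn k (w d) = kdn k d].
Proof.
move=> rd; have := @wcross_C P k d (w d) erefl.
by move: rd; rewrite /kdn; case: (t d).
Qed.

Lemma abasE g d : abas g d = (d == g)%:R.
Proof. by rewrite ffunE. Qed.

Lemma sum_abasE (A : {set Dsig P}) (f : Dsig P -> laurent) e :
  (\sum_(d in A) f d *: abas d) e = if e \in A then f e else 0.
Proof.
rewrite sum_ffunE.
rewrite (eq_bigr (fun d => if d == e then f e else 0)); last first.
  move=> d _; rewrite ffunE abasE eq_sym; case: eqP => [->|_].
    exact: mulr1.
  exact: mulr0.
rewrite -big_mkcondr /=; case: ifP => eA.
  by rewrite (big_pred1 e) // => d; rewrite andbC /=; case: eqP => [->|].
by rewrite big_pred0 // => d; rewrite andbC; case: eqP => [->|].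
Qed.

Lemma lvE (x y z : laurent) g h (s : lvM P) e :
  (x *: abas g + y *: abas h + z *: s) e =
    x * (e == g)%:R + y * (e == h)%:R + z * s e.
Proof. by rewrite !ffunE. Qed.

Local Notation sgn := (eps Md k).

Lemma sgnE g d : sgn g d = 1 \/ sgn g d = -1.
Proof. by rewrite /eps /epsilon; case: (t g); auto; case: ifP; auto. Qed.

Lemma eps_sum_up g : t g <> t2i12 -> ~~ tau_mem k g ->
  \sum_(d in kup k g) sgn d g *: abas d = \sum_(d in kup k g) abas d.
Proof.
move=> ng ag; apply: eq_bigr => d /(kupP ag)[_ pd _].
have -> : sgn d g = 1; last by rewrite scale1r.
by rewrite /eps /epsilon; move: pd ng; case: (t d) => //; case: (t g).
Qed.

Lemma T_ascent g : ~~ tau_mem k g ->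
  T (abas g) = up_diag (t g) *: abas g + up_cross (t g) *: abas (w g)
    + up_cayley (t g) *: \sum_(d in kup k g) sgn d g *: abas d.
Proof.
move=> ag; rewrite T_basis /T_formula.
have kup0 : cayley_card (t g) = 0%N -> kup k g = set0.
  by move=> c0; apply/eqP; rewrite -cards_eq0 -c0; rewrite /kup kup_card.
have eup := eps_sum_up (g := g).
move: ag kup0 eup; rewrite /tau_mem /up_cayley.
case: (t g) => ag kup0 eup; try discriminate ag.
all: cbv iota; rewrite /up_diag /up_cross /has_defect.
all: rewrite ?scale0r ?scale1r ?scaleN1r ?add0r ?addr0.
all: first [ rewrite (kup0 erefl) big_set0 ?addr0; reflexivity
           | rewrite eup //; reflexivity | reflexivity ].
Qed.

Lemma T_descent g : tau_mem k g ->
  T (abas g) = dn_diag (t g) *: abas g + dn_cross (t g) *: abas (w g)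
    + dn_cayley (t g) *: \sum_(d in kdn k g) sgn g d *: abas d.
Proof.
move=> ag; rewrite T_basis /T_formula.
have kdn0 : cayley_card (t g) = 0%N -> kdn k g = set0.
  by move=> c0; apply/eqP; rewrite -cards_eq0 -c0; rewrite /kdn kdn_card.
have edn : t g <> t2r21 ->
   \sum_(d in kdn k g) sgn g d *: abas d = \sum_(d in kdn k g) abas d.
  move=> ng; apply: eq_bigr => d _.
  have -> : sgn g d = 1; last by rewrite scale1r.
  by rewrite /eps /epsilon; move: ng; case: (t g).
move: ag kdn0 edn; rewrite /tau_mem /dn_cayley (ell_leading g).
case: (t g) => ag kdn0 edn; try discriminate ag.
all: cbv iota; rewrite /dn_diag /dn_cross /has_defect /leading_digit.
all: rewrite ?scale0r ?scale1r ?scaleN1r ?add0r ?addr0.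
all: first [ rewrite (kdn0 erefl) big_set0 ?scaler0 ?addr0; reflexivity
           | rewrite edn //; reflexivity | reflexivity ].
Qed.

Lemma T_ascentE g e : ~~ tau_mem k g ->
  T (abas g) e = up_diag (t g) * (e == g)%:R + up_cross (t g) * (e == w g)%:R
    + up_cayley (t g) * (if e \in kup k g then sgn e g else 0).
Proof.
by move=> ag; rewrite (T_ascent ag) lvE sum_abasE.
Qed.

Lemma T_descentE g e : tau_mem k g ->
  T (abas g) e = dn_diag (t g) * (e == g)%:R + dn_cross (t g) * (e == w g)%:R
    + dn_cayley (t g) * (if e \in kdn k g then sgn g e else 0).
Proof.
by move=> ag; rewrite (T_descent ag) lvE sum_abasE.
Qed.
End Cayley.

(** * Arrows and the matrix of the action *)

Section HeckeAction.
Variables (P : lv_params) (Md : lv_module P) (k : Sbar P).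
Implicit Types (g d e : Dsig P).

Local Notation t g := (ty g k).
Local Notation w := (wcross k).
Local Notation T := (Tk Md k).
Local Notation sgn := (eps Md k).

Lemma wcross_Cminus g : is_Cminus (t g) -> ~~ tau_mem k (w g).
Proof.
move=> cg; have := @wcross_C P k g (w g) erefl.
by rewrite /tau_mem; move: cg; case: (t g) => // _ ->.
Qed.

Lemma wcross_Cplus g : is_Cplus (t g) -> is_Cminus (t (w g)).
Proof.
move=> cg; have := @wcross_C P k g (w g) erefl.
by move: cg; case: (t g) => // _ ->.
Qed.

Lemma is_Cminus_descent g : is_Cminus (t g) -> tau_mem k g.
Proof. by rewrite /tau_mem; case: (t g). Qed.

Lemma descent_ascent_neq g d : tau_mem k g -> ~~ tau_mem k d -> (d == g) = false.
Proof. by move=> tg td; apply/eqP => e; rewrite e tg in td. Qed.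

Lemma kdn_Cminus g : is_Cminus (t g) -> kdn k g = set0.
Proof.
move=> cg; apply/eqP; rewrite -cards_eq0 /kdn kdn_card; last exact: is_Cminus_descent.
by move: cg; case: (t g).
Qed.

(** Cayley transforms and complex descents lead to ascents, which leaves only the
    term -a_{w x g} of types 1r2 and 2r22. *)
Lemma T_descent_descent g e : tau_mem k g -> tau_mem k e -> e != g ->
  T (abas g) e = if is_type2_real (t g) && (e == w g) then -1 else 0.
Proof.
move=> tg te neg; rewrite (T_descentE _ _ tg) (negPf neg) mulr0 add0r.
have -> : (e \in kdn k g) = false.
  by apply/negP => /(kdnP tg)[ne _ _]; rewrite te in ne.
rewrite mulr0 addr0.
case: (boolP (is_Cminus (t g))) => cg.
  have -> : (e == w g) = false.
    by rewrite eq_sym; apply: descent_ascent_neq te (wcross_Cminus cg).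
  by rewrite mulr0 andbF.
rewrite /dn_cross; case: (e == w g); last by rewrite mulr0 andbF.
by rewrite mulr1 andbT; move: cg tg; rewrite /tau_mem; case: (t g).
Qed.

(** For a descent g the coefficients of ascents in the formula for T a_g are, up
    to sign, powers of v or differences of two distinct ones. None of them
    vanishes, so the arrows depend on the combinatorics alone. *)
Lemma arrowE g d : tau_mem k g ->
  arrow Md k g d = if is_Cminus (t g) then d == w g else d \in kdn k g.
Proof.
move=> tg; rewrite /arrow /arrow_for tg andTb.
case: (boolP (tau_mem k d)) => td; last rewrite andTb.
  transitivity false => //.
  case: ifP => cg.
    by rewrite eq_sym (descent_ascent_neq td (wcross_Cminus cg)).
  by apply/esym/negP => /(kdnP tg)[nd _ _]; rewrite td in nd.
rewrite (T_descentE _ _ tg) (descent_ascent_neq tg td) mulr0 add0r.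
case: (boolP (is_Cminus (t g))) => cg.
  rewrite (kdn_Cminus cg) in_set0 mulr0 addr0.
  have -> : dn_cross (t g) = u ^+ leading_digit (t g) by move: cg; case: (t g).
  exact/mulr_bool_neq0/uX_neq0.
have -> : dn_cross (t g) * (d == w g)%:R = 0.
  case: eqP => [e|_]; last by rewrite mulr0.
  rewrite mulr1; case: (boolP (is_type2_real (t g))) => rg.
    have [_ tw _] := kdn_type2_real rg.
    by move: td; rewrite e /tau_mem tw -/(tau_mem k g) tg.
  by move: cg rg; case: (t g).
rewrite add0r; case: ifP => _; last by rewrite mulr0 eqxx.
by rewrite mulr_sign_neq0 ?dn_cayley_neq0 //; apply: sgnE.
Qed.

Lemma T_square g :
  T (T (abas g)) = (u ^+ ell k - 1) *: T (abas g) + u ^+ ell k *: abas g.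
Proof. exact/linear_quadratic/T_quadratic. Qed.

Lemma T_squareE g e : T (T (abas g)) e =
  (u ^+ ell k - 1) * T (abas g) e + u ^+ ell k * (e == g)%:R.
Proof. by rewrite T_square !ffunE. Qed.

(** For a complex ascent T a_g is the single basis vector a_{w x g}, so the
    quadratic relation at a_g reads u^n (a_{w x w x g} - a_g) = 0. *)
Lemma wcross_wcross_Cplus g : is_Cplus (t g) -> w (w g) = g.
Proof.
move=> pg; have cw := wcross_Cplus pg.
have tw := is_Cminus_descent cw.
have ag : ~~ tau_mem k g by move: pg; rewrite /tau_mem; case: (t g).
have Tg : T (abas g) = abas (w g).
  rewrite (T_ascent _ ag).
  have -> : kup k g = set0.
    apply/eqP; rewrite -cards_eq0 /kup kup_card //.
    by move: pg; case: (t g).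
  rewrite big_set0 scaler0 addr0.
  have [-> ->] : up_diag (t g) = 0 /\ up_cross (t g) = 1.
    by move: pg; case: (t g).
  by rewrite scale0r scale1r add0r.
have := T_squareE g g; rewrite Tg (T_descentE _ _ tw) abasE.
rewrite (descent_ascent_neq tw ag) eqxx (kdn_Cminus cw) in_set0 !mulr0 addr0 !add0r.
have -> : dn_cross (t (w g)) = u ^+ ell k.
  by rewrite (ell_leading k (w g)); move: cw; case: (t (w g)).
case: eqP => // _; rewrite mulr1 mulr0 => /eqP.
by rewrite eq_sym (negPf (uX_neq0 _)).
Qed.

(** Let h be the Cayley transform of g, so T a_g = a_{w x g} + a_h. The component
    on a_h of the quadratic relation at a_g would force the coefficient of a_h in
    T a_{w x g} to be 1; but between distinct descents such a coefficient is 0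
    or -1. *)
Lemma wcross_type1_ascent g : is_type1_imaginary (t g) -> ~~ tau_mem k (w g).
Proof.
move=> ig; apply/negP => tw.
have ag : ~~ tau_mem k g by move: ig; rewrite /tau_mem; case: (t g).
have [h kh] : exists h, kup k g = [set h].
  apply/cards1P; rewrite /kup kup_card //.
  by move: ig; case: (t g).
have hg : h \in kup k g by rewrite kh set11.
have [th ph _] := kupP ag hg.
have Tg : T (abas g) = abas (w g) + abas h.
  rewrite (T_ascent _ ag) eps_sum_up //; last by move: ig; case: (t g).
  rewrite kh big_set1.
  have [-> -> ->] : [/\ up_diag (t g) = 0, up_cross (t g) = 1
                      & up_cayley (t g) = 1].
    by move: ig; rewrite /up_cayley; case: (t g).
  by rewrite scale0r !scale1r add0r.
have Thh : T (abas h) h = u ^+ ell k - 2.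
  rewrite (T_descentE _ _ th) eqxx mulr1 (ell_leading k h).
  have -> : (h \in kdn k h) = false.
    by apply/negP => /(kdnP th)[]; rewrite th.
  rewrite mulr0 addr0.
  by move: ph ig; case: (t g) => //= -[<-] _; rewrite mul0r addr0.
have := T_squareE g h; rewrite Tg linearD /=.
rewrite [in LHS]ffunE [in X in _ = X -> _]ffunE Thh !abasE eqxx.
have -> : (h == g) = false by rewrite eq_sym (descent_ascent_neq th ag).
rewrite mulr0 addr0.
(* The case w x g = h, where a_h occurs in T a_g with coefficient 2. *)
have [hw|hw] := eqVneq h (w g).
  rewrite -hw Thh => /type1_square_eq2/eqP.
  by rewrite (negPf (natr_laurent_neq0 1)).
rewrite (T_descent_descent tw th hw) => /type1_square_eq1/eqP.
case: ifP => _; last by rewrite eq_sym oner_eq0.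
by rewrite -subr_eq0 -opprD oppr_eq0 (negPf (natr_laurent_neq0 1)).
Qed.

(** Up-transforms and complex ascents reverse the arrows; the cross term of types
    1i1 and 2i11 is the only other source of basis vectors, and it is an
    ascent. *)
Lemma T_ascent_descent g d : ~~ tau_mem k g -> tau_mem k d ->
  T (abas g) d = 0 \/
  arrow Md k d g /\ exists s : laurent,
    (s = 1 \/ s = -1) /\ T (abas g) d = (if def_at k d then u + 1 else 1) * s.
Proof.
move=> ag td; rewrite (T_ascentE _ _ ag).
rewrite eq_sym (descent_ascent_neq td ag) mulr0 add0r.
case: (boolP (d \in kup k g)) => dg.
  right; have [_ pg gd] := kupP ag dg.
  have cross0 : up_cross (t g) * (d == w g)%:R = 0.
    case: eqP => [e|_]; last by rewrite mulr0.
    case: (boolP (is_type1_imaginary (t g))) => ig.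
      by have := wcross_type1_ascent ig; rewrite -e td.
    by move: ig pg; case: (t g) => //= _ _; rewrite mul0r.
  rewrite cross0 add0r; split.
    rewrite (arrowE _ td) gd ifN //.
    by move: pg; case: (t g) => //= -[<-].
  exists (sgn d g); split; first exact: sgnE.
  rewrite /up_cayley /def_at.
  have -> // : has_defect (t g) = has_defect (t d).
  by move: pg; case: (t g) => //= -[<-].
rewrite mulr0 addr0.
case: eqP => [dw|_]; last by left; rewrite mulr0.
case: (boolP (is_Cplus (t g))) => pg; last first.
  left; case: (boolP (is_type1_imaginary (t g))) => ig.
    by have := wcross_type1_ascent ig; rewrite -dw td.
  by move: ig pg; case: (t g) => //= _ _; rewrite mul0r.
right; have cd := wcross_Cplus pg; rewrite -dw in cd.
split; first by rewrite (arrowE _ td) cd dw (wcross_wcross_Cplus pg) eqxx.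
exists 1; split; first by left.
rewrite /def_at ifN; last by move: cd; case: (t d).
have -> : up_cross (t g) = 1 by move: pg; case: (t g).
by rewrite !mulr1.
Qed.
End HeckeAction.

(** * Degree bounds for the canonical basis *)

Section CanonicalBasis.
Variables (P : lv_params) (Md : lv_module P) (k : Sbar P).
Implicit Types (g d e l : Dsig P).

Local Notation t g := (ty g k).
Local Notation w := (wcross k).
Local Notation T := (Tk Md k).
Local Notation len g := (plen (val g)).

(** The coefficient of [ahat d] in That [ahat g]. *)
Definition hatcoef d g : laurent :=
  vpow ((len d)%:Z - (len g)%:Z - (ell k)%:Z) * (T (abas g) d + (d == g)%:R).

(** Both parameters have an arrow to the same ascent, and an arrow fixes the
    difference of lengths. *)
Lemma plen_type2_real g : tau_mem k g -> is_type2_real (t g) -> len (w g) = len g.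
Proof.
move=> tg rg; have [_ tw kw] := kdn_type2_real rg.
have [d dg] : exists d, d \in kdn k g.
  apply/card_gt0P; rewrite /kdn kdn_card //.
  by move: rg; case: (t g).
have twg : tau_mem k (w g) by rewrite /tau_mem tw.
have nc : ~~ is_Cminus (t g) by move: rg; case: (t g).
have ag : arrow Md k g d by rewrite (arrowE Md d tg) (negPf nc).
have aw : arrow Md k (w g) d by rewrite (arrowE Md d twg) tw (negPf nc) kw.
have [lg _] := arrow_len ag; have [lw _] := arrow_len aw.
have dd : def_at k (w g) = def_at k g by rewrite /def_at tw.
by move: lg lw; rewrite dd => <- /addIr[].
Qed.

(** Between distinct descents the only contribution is the -1 of types 1r2 and
    2r22, at equal lengths, which gives -v^{-n}. Along an arrow d -> g the power
    of v is v^{-def}, multiplied by a sign and, for defect 1, by u + 1. *)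
Lemma hatcoef_cases d g : tau_mem k d -> g <> d ->
  [\/ tau_mem k g /\ degle 0 (hatcoef d g), hatcoef d g = 0
    | arrow Md k d g /\ degle (def_at k d)%:Z (hatcoef d g)].
Proof.
move=> td gd; have dg : d != g by apply/eqP => e; apply: gd.
rewrite /hatcoef (negPf dg) addr0.
case: (boolP (tau_mem k g)) => tg.
  constructor 1; split=> //; rewrite (T_descent_descent Md tg td dg).
  case: ifP => [/andP[rg /eqP ->]|_]; last by rewrite mulr0; apply: degle0.
  rewrite (plen_type2_real tg rg) mulrN1; apply/degleN/degle_vpow.
  by lia.
case: (T_ascent_descent Md tg td) => [->|[adg [s [s1 ->]]]].
  by constructor 2; rewrite mulr0.
constructor 3; split=> //.
have [lg _] := arrow_len adg.
have -> : (len d)%:Z - (len g)%:Z - (ell k)%:Z = - (def_at k d)%:Z by lia.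
have ds : degle 0 s.
  by case: s1 => ->; [|apply: degleN]; rewrite -vpow0; apply: degle_vpow.
rewrite mulrA -[(def_at k d)%:Z]addr0; apply: degleM => //.
case: (def_at k d); rewrite /= ?mulr1.
  rewrite -(vpow0) /u mulrDr !vpowM; apply: degleD; exact: degle_vpow.
exact: degle_vpow.
Qed.

Variable C : lv_canonical Md.

Lemma lv_scaleE (c : laurent) (x : lvM P) e : (c *: x) e = c * x e.
Proof. by rewrite ffunE. Qed.

Lemma lv_addE (x y : lvM P) e : (x + y) e = x e + y e.
Proof. by rewrite ffunE. Qed.

Lemma ahatE g e : ahat g e = vpow (- (len g)%:Z) * (e == g)%:R.
Proof. by rewrite /ahat lv_scaleE abasE. Qed.

Lemma ChatE d e : Chat C d e = Phat C e d * vpow (- (len e)%:Z).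
Proof.
rewrite Chat_Phat sum_ffunE (bigD1 e) //= big1 ?addr0.
  by rewrite lv_scaleE ahatE eqxx mulr1.
by move=> g ge; rewrite lv_scaleE ahatE eq_sym (negPf ge) !mulr0.
Qed.

Lemma ThatE (x : lvM P) d :
  That Md k x d = \sum_g x g * vpow (- (ell k)%:Z) * (T (abas g) d + (d == g)%:R).
Proof.
have ex : x = \sum_g x g *: abas g.
  apply/ffunP => e; rewrite sum_ffunE (bigD1 e) //= big1 ?addr0.
    by rewrite lv_scaleE abasE eqxx mulr1.
  by move=> g ge; rewrite lv_scaleE abasE eq_sym (negPf ge) mulr0.
rewrite /That /That_for lv_scaleE [in LHS]ex linear_sum -big_split /= sum_ffunE.
rewrite mulr_sumr; apply: eq_bigr => g _.
rewrite linearZ -scalerDr lv_scaleE lv_addE abasE.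
by rewrite mulrA [vpow _ * _]mulrC.
Qed.

Lemma That_Chat_coef d l :
  vpow (len d)%:Z * That Md k (Chat C l) d = \sum_g Phat C g l * hatcoef d g.
Proof.
rewrite ThatE mulr_sumr; apply: eq_bigr => g _.
by rewrite ChatE mulr_shuffle !vpowM.
Qed.

Lemma That_Chat_mk d l : ~~ tau_mem k l ->
  vpow (len d)%:Z * That Md k (Chat C l) d =
    \sum_(e | tau_mem k e) Phat C d e * mk C k e l.
Proof.
move=> tl; rewrite (That_Chat C tl) sum_ffunE mulr_sumr.
apply: eq_bigr => e _; rewrite lv_scaleE ChatE.
rewrite mulrCA [vpow _ * (_ * _)]mulrCA vpowM subrr vpow0 mulr1.
exact: mulrC.
Qed.

Lemma degle_Phat d e : d <> e -> degle (-1) (Phat C d e).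
Proof. by move=> de n n1; apply: Phat_neg => //; lia. Qed.

Lemma Phat_eq0 d l : d <> l -> ~~ plt C d l -> Phat C d l = 0.
Proof.
move=> /eqP dl; rewrite /plt dl andbT => nle.
by apply/eqP/negPn/negP => /eqP/Phat_le; apply/negP.
Qed.

Lemma arrow_descent d l : arrow Md k d l -> tau_mem k d.
Proof. by case/and3P. Qed.

Lemma arrow_ascent d l : arrow Md k d l -> ~~ tau_mem k l.
Proof. by case/and3P. Qed.

(** The types with a defect have singleton Cayley transforms in both
    directions. *)
Lemma arrow_def d l : arrow Md k d l -> def_at k d ->
  [/\ kdn k d = [set l], def_at k l & kup k l = [set d]].
Proof.
move=> adl dd; have [_ dl] := arrow_len adl.
have td := arrow_descent adl; have tl := arrow_ascent adl.
have ld : l \in kdn k d.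
  by move: adl; rewrite (arrowE Md l td) ifN //; move: dd; rewrite /def_at; case: (t d).
have [_ _ du] := kdnP td ld.
have card1 (A : {set Dsig P}) x : #|A| = 1%N -> x \in A -> A = [set x].
  by move=> /eqP/cards1P[y ->]; rewrite inE => /eqP ->.
split.
- apply: card1 ld; rewrite /kdn kdn_card //.
  by move: dd td; rewrite /def_at; case: (t d).
- by rewrite dl.
apply: card1 du; rewrite /kup kup_card //.
by move: dl; rewrite dd /def_at; case: (t l).
Qed.

(** Downward induction on the length of d; the vanishing of m(d,l) relies on the
    two degree bounds for the longer e. In a term P(d,e) m(e,l) with e > d the
    first factor has degree at most -1, the second at most 0 unless there is an
    arrow e -> l of defect 1. In that exceptional case the degree of m(e,l) is at
    most 1, e is the Cayley transform of l, and the v^0 term of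
    P(d,e) m(e,l) is governed by mu_{-1}(d, l^kappa), which vanishes unless d
    precedes l. Symmetrically, on the side of C_l the exceptional terms are those
    of the Cayley transform of d, governed by mu_{-1}(d_kappa, l). *)
Lemma mk_degree l : ~~ tau_mem k l -> forall d, tau_mem k d -> ~~ plt C d l ->
  [/\ degle 1 (mk C k d l),
      ~~ (arrow Md k d l && def_at k d) -> degle 0 (mk C k d l)
    & ~~ arrow Md k d l -> ~~ prec C k d l -> mk C k d l = 0].
Proof.
move=> tl d; pose N := (\max_(e : Dsig P) len e)%N.
have [n] := ubnP (N - len d)%N; elim: n d => // n IH d dn td ndl.
have dl : d <> l by move=> e; rewrite e (negPf tl) in td.
have Pdl := Phat_eq0 dl ndl.
pose X := \sum_g Phat C g l * hatcoef d g.
pose R := \sum_(e | tau_mem k e && (e != d)) Phat C d e * mk C k e l.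
have mkE : mk C k d l = X - R.
  rewrite /X -That_Chat_coef (That_Chat_mk d tl) (bigD1 d) //= Phat_diag mul1r.
  by rewrite addrK.
(* The bounds for the contributions of the canonical basis elements C_e. *)
have Rterm e : tau_mem k e && (e != d) ->
    degle 0 (Phat C d e * mk C k e l) /\
    (~~ prec C k d l -> degle (-1) (Phat C d e * mk C k e l)).
  move=> /andP[te /eqP ed].
  have [->|/eqP Pde] := eqVneq (Phat C d e) 0.
    by rewrite mul0r; split=> [|_]; apply: degle0.
  have de : d <> e by move=> E; apply: ed.
  have lde := Phat_le Pde; have hlen := plt_len lde de.
  have nel : ~~ plt C e l.
    apply: contra ndl => /andP[lel _]; apply/andP; split; last exact/eqP.
    exact: ple_trans lde lel.
  have eN : (len e <= N)%N by apply: (leq_bigmax e).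
  have [|e1 e0 _] := IH e _ te nel; first by lia.
  have dP := degle_Phat de.
  case: (boolP (arrow Md k e l && def_at k e)) => [/andP[ael de1]|nae].
    split; first by rewrite -[0](addNr 1); apply: degleM.
    (* Degree -2 for P(d,e) against degree 1 for m(e,l). *)
    move=> npr; rewrite (_ : -1 = (-1 - 1) + 1) //; apply: degleM e1.
    apply: degle_pred => //.
    have [_ dfl kl] := arrow_def ael de1.
    move: npr; rewrite /prec dfl ndl /= !negb_or => /and3P[_ _].
    by rewrite negb_exists => /forallP/(_ e); rewrite kl set11 negbK => /eqP.
  have dm : degle (-1) (Phat C d e * mk C k e l).
    by rewrite -[-1]addr0; apply: degleM (e0 nae).
  by split=> [|_ //]; apply: degle_mono dm.
(* The bounds for the contributions of the terms P(g,l) of C_l; the strongest,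
   degree at most -1, fails only for g = l and across a defect. *)
have Xterm g :
    [/\ degle 1 (Phat C g l * hatcoef d g),
       ~~ (arrow Md k d l && def_at k d) -> degle 0 (Phat C g l * hatcoef d g)
     & ~~ arrow Md k d l -> ~~ prec C k d l ->
         degle (-1) (Phat C g l * hatcoef d g)].
  have all_of (x : laurent) : degle (-1) x -> [/\ degle 1 x,
       ~~ (arrow Md k d l && def_at k d) -> degle 0 x
     & ~~ arrow Md k d l -> ~~ prec C k d l -> degle (-1) x].
    by move=> dx; split=> [|_|_ _] //; apply: degle_mono dx.
  have [->|/eqP gd] := eqVneq g d.
    by rewrite Pdl mul0r; apply/all_of/degle0.
  case: (hatcoef_cases td gd) => [[tg h0]|->|[adg hdef]].
  - apply: all_of; rewrite -[-1]addr0; apply: degleM => //.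
    by apply: degle_Phat => e; rewrite -e tg in tl.
  - by rewrite mulr0; apply/all_of/degle0.
  have [gl|/eqP gl] := eqVneq g l.
    rewrite gl Phat_diag mul1r in adg hdef *; rewrite adg /=.
    split=> // [|nd]; first by apply: degle_mono hdef; case: (def_at k d).
    by apply: degle_mono hdef; rewrite (negPf nd).
  have dP := degle_Phat gl.
  have /orP[dd|dd] := orbN (def_at k d); last first.
    apply: all_of; rewrite -[-1]addr0; apply: degleM => //.
    by apply: degle_mono hdef; rewrite (negPf dd).
  have d0 : degle 0 (Phat C g l * hatcoef d g).
    by rewrite -[0](addNr 1); apply: degleM => //; apply: degle_mono hdef; case: (def_at k d).
  split=> //; first by apply: degle_mono d0.
  (* Degree -2 for P(g,l) against degree 1 for its factor v + v^-1. *)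
  move=> _ npr; rewrite (_ : -1 = (-1 - 1) + 1) //; apply: degleM; last first.
    by apply: degle_mono hdef; case: (def_at k d).
  apply: degle_pred => //.
  have [kd _ _] := arrow_def adg dd.
  move: npr; rewrite /prec dd ndl /= !negb_or => /and3P[_ + _].
  by rewrite negb_exists => /forallP/(_ g); rewrite kd set11 negbK => /eqP.
have d0R : degle 0 R by apply: degle_sum => e /Rterm[].
split.
- rewrite mkE; apply: degleD; first by apply: degle_sum => g _; case: (Xterm g).
  by apply/degleN; apply: degle_mono d0R.
- move=> nad; rewrite mkE; apply: degleD; last exact: degleN.
  by apply: degle_sum => g _; case: (Xterm g) => _ /(_ nad).
move=> nad npr; apply: lbar_degle_eq0; first exact: mk_bar.
rewrite mkE; apply: degleD.
  by apply: degle_sum => g _; case: (Xterm g) => _ _ /(_ nad npr).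
by apply/degleN; apply: degle_sum => e /Rterm[_ /(_ npr)].
Qed.

(** The arrow forces d to be longer than l, and under a defect the Cayley
    transforms in the other two conditions are l and d themselves; mu_{-1}
    vanishes on the diagonal. *)
Lemma arrow_not_prec d l : arrow Md k d l -> ~~ prec C k d l.
Proof.
move=> adl; have [ldl dd] := arrow_len adl.
have mu0 e : mu1 C e e = 0 by rewrite /mu1 Phat_diag mcoeff_one.
have gt := ell_gt_def k d.
rewrite /prec !negb_or; apply/and3P; split.
- apply/negP => /andP[le /eqP ne].
  by have := plt_len le ne; lia.
- apply/negP => /and3P[hd _ /existsP[e /andP[]]].
  have [-> _ _] := arrow_def adl hd.
  by rewrite inE => /eqP ->; rewrite mu0.
apply/negP => /and3P[hl _ /existsP[e /andP[]]].
rewrite dd in hl; have [_ _ ->] := arrow_def adl hl.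
by rewrite inE => /eqP ->; rewrite mu0.
Qed.

Lemma akhat_descent g e : tau_mem k e ->
  akhat Md k g e = vpow (- (len g)%:Z) * (e == g)%:R.
Proof.
move=> te; rewrite /akhat /akhat_for lv_addE sum_ffunE ahatE big1 ?addr0 //.
move=> d adg; rewrite lv_scaleE ahatE.
have -> : (e == d) = false.
  by rewrite eq_sym (descent_ascent_neq te (arrow_ascent adg)).
by rewrite !mulr0.
Qed.

(** Arrows end in ascents, so among the [akhat k d] only [akhat k g] involves
    [ahat g]. *)
Lemma akcoefE (x : lvM P) g : tau_mem k g ->
  akcoef Md k x g = vpow (len g)%:Z * That Md k x g.
Proof.
move=> tg; rewrite /akcoef /That; set ex := That_span Md k x.
rewrite {2}(eqP (xchooseP ex)) sum_ffunE (bigD1 g) //= big1 ?addr0.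
  rewrite lv_scaleE (akhat_descent g tg) eqxx mulr1.
  by rewrite mulrCA vpowM subrr vpow0 mulr1.
move=> d /andP[_ dg].
by rewrite lv_scaleE (akhat_descent d tg) eq_sym (negPf dg) !mulr0.
Qed.

Lemma arrow_exists mu : tau_mem k mu ->
  [/\ t mu <> t1r1s, t mu <> t1ic, t mu <> t2ic & t mu <> t3ic] ->
  exists l, arrow Md k mu l.
Proof.
move=> tmu nty; case: (boolP (is_Cminus (t mu))) => cmu.
  by exists (w mu); rewrite (arrowE Md _ tmu) cmu.
have /card_gt0P[l lmu] : (0 < #|kdn k mu|)%N.
  rewrite /kdn kdn_card //; move: tmu nty cmu; rewrite /tau_mem.
  by case: (t mu) => // _ [].
by exists l; rewrite (arrowE Md _ tmu) (negPf cmu).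
Qed.
End CanonicalBasis.

(** * Sources of the arrows into an ascent *)

Section Sources.
Variables (P : lv_params) (Md : lv_module P) (k : Sbar P).
Implicit Types (g d e l mu : Dsig P).

Local Notation t g := (ty g k).
Local Notation w := (wcross k).

Lemma arrow_sources_Cminus mu l : is_Cminus (t mu) -> arrow Md k mu l ->
  forall mu', arrow Md k mu' l = (mu' == mu).
Proof.
move=> cmu amu mu'; have tmu := is_Cminus_descent cmu.
move: (amu); rewrite (arrowE Md l tmu) cmu => /eqP lw.
apply/idP/eqP => [amu'|-> //].
have tmu' := arrow_descent amu'.
move: amu'; rewrite (arrowE Md l tmu'); case: ifP => cmu'.
  by move=> /eqP; rewrite lw => /wcross_inj.
move=> /(kdnP tmu')[_ pl _].
have := @wcross_C P k mu l (congr1 val lw).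
by move: cmu; case: (t mu) => // _ tl; rewrite tl in pl.
Qed.

(** The type of l determines whether its incoming arrows are complex or Cayley. *)
Lemma arrow_sources_kup mu l : ~~ is_Cminus (t mu) -> arrow Md k mu l ->
  mu \in kup k l /\ forall mu', arrow Md k mu' l = (mu' \in kup k l).
Proof.
move=> cmu amu; have tmu := arrow_descent amu; have tl := arrow_ascent amu.
move: (amu); rewrite (arrowE Md l tmu) (negPf cmu) => lmu.
have [_ pl mul] := kdnP tmu lmu.
split=> // mu'; apply/idP/idP => [amu'|mul'].
  have tmu' := arrow_descent amu'.
  move: amu'; rewrite (arrowE Md l tmu').
  case: ifP => [cmu' /eqP lw|_ /(kdnP tmu')[] //].
  have := @wcross_C P k mu' l (congr1 val lw).
  by move: cmu'; case: (t mu') => // _ e; rewrite e in pl.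
have [tmu' pl' lmu'] := kupP tl mul'.
rewrite (arrowE Md l tmu') lmu' ifN //.
by move: pl'; case: (t l) => //= -[<-].
Qed.

Lemma sources_type2_real mu l : is_type2_real (t mu) -> arrow Md k mu l ->
  [set mu' | arrow Md k mu' l] = [set mu; w mu].
Proof.
move=> rmu amu; have tmu := arrow_descent amu; have tl := arrow_ascent amu.
have nc : ~~ is_Cminus (t mu) by move: rmu; case: (t mu).
have [mul src] := arrow_sources_kup nc amu.
have -> : [set mu' | arrow Md k mu' l] = kup k l.
  by apply/setP => mu'; rewrite inE src.
have [wmu twmu kwmu] := kdn_type2_real rmu.
apply: set2_of_card2 => //; last by move=> e; apply: wmu.
- have [_ pl _] := kupP tl mul.
  by rewrite /kup kup_card //; move: pl rmu; case: (t l) => //= -[<-].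
rewrite -src (arrowE Md l) ?/tau_mem ?twmu // (negPf nc) kwmu.
by have [_ _ ->] := kupP tl mul.
Qed.

(** The two members of the ordered pair of mu are mu and s_alpha x mu; they share
    their Cayley transform, hence both lie in the two-element transform of l. *)
Lemma sources_2r21 mu l i : t mu = t2r21 -> i \in val k -> arrow Md k mu l ->
  val @: [set mu' | arrow Md k mu' l] = [set val mu; scross i (val mu)].
Proof.
move=> rmu ki amu; have tl := arrow_ascent amu.
have nc : ~~ is_Cminus (t mu) by rewrite rmu.
have [mul src] := arrow_sources_kup nc amu.
have -> : [set mu' | arrow Md k mu' l] = kup k l.
  by apply/setP => mu'; rewrite inE src.
have [_ pl lmu] := kupP tl mul.
have [pE pne _ [t1 t2] kp] := rpairP Md rmu ki.
move: (rpair Md k mu).1 (rpair Md k mu).2 pE pne t1 t2 kp => p1 p2 pE pne t1 t2 kp.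
have kmu : kdn k p1 = kdn k mu.
  have : val mu \in [set val p1; val p2] by rewrite pE set21.
  by rewrite !inE => /orP[] /eqP/val_inj ->.
rewrite (@set2_of_card2 _ (kup k l) p1 p2) //.
- by rewrite imsetU1 imset_set1.
- by rewrite /kup kup_card //; move: pl; rewrite rmu; case: (t l).
- by rewrite -src (arrowE Md l) ?/tau_mem t1 // kmu.
by rewrite -src (arrowE Md l) ?/tau_mem t2 // -kp kmu.
Qed.

Lemma sources_single mu l :
  ~~ is_type2_real (t mu) -> t mu <> t2r21 -> arrow Md k mu l ->
  [set mu' | arrow Md k mu' l] = [set mu].
Proof.
move=> nr n21 amu; have tl := arrow_ascent amu.
have [cmu|cmu] := boolP (is_Cminus (t mu)).
  by apply/setP => mu'; rewrite !inE (arrow_sources_Cminus cmu amu).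
have [mul src] := arrow_sources_kup cmu amu.
have -> : [set mu' | arrow Md k mu' l] = kup k l.
  by apply/setP => mu'; rewrite inE src.
have [_ pl _] := kupP tl mul.
have /eqP/cards1P[x kx] : #|kup k l| = 1%N.
  by rewrite /kup kup_card //; move: pl nr n21; case: (t l) => //= -[<-].
by move: mul; rewrite kx inE => /eqP ->.
Qed.
End Sources.

Theorem proposition10p2p6 (P : lv_params) (Md : lv_module P)
    (C : lv_canonical Md) (k : Sbar P) (g mu : Dsig P)
    (hg : tau_mem k g) (hmu : tau_mem k mu)
    (hty : [/\ ty mu k <> t1r1s, ty mu k <> t1ic, ty mu k <> t2ic
             & ty mu k <> t3ic]) :
  (exists l : Dsig P, arrow Md k mu l) /\
  forall l : Dsig P, arrow Md k mu l ->
    \sum_(mu' : Dsig P | arrow Md k mu' l) Phat C g mu' * mk C k mu' l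
      = akcoef Md k (Chat C l) g - Uhat C k g l
    /\ forall i : sidx P, i \in val k ->
         [set val mu' | mu' : Dsig P & arrow Md k mu' l]
           = match ty mu k with
             | t1r2 | t2r22 => [set val mu; cross P (val mu) (wk k)]
             | t2r21 => [set val mu; cross P (val mu) (srefl i)]
             | _ => [set val mu]
             end.
Proof.
split; first exact: arrow_exists.
move=> l amu; have tl := arrow_ascent amu; split.
  rewrite (akcoefE _ _ hg) (That_Chat_mk C g tl) /Uhat.
  rewrite [in RHS](bigID (fun d => prec C k d l)) /= [RHS]addrC addKr.
  rewrite big_mkcond [RHS]big_mkcond; apply: eq_bigr => d _.
  have [ad|nad] := boolP (arrow Md k d l).
    by rewrite (arrow_descent ad) (arrow_not_prec C ad).
  case: ifP => // /andP[td npr].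
  have ndl : ~~ plt C d l by move: npr; rewrite /prec !negb_or => /and3P[].
  by have [_ _ ->] := mk_degree tl td ndl; rewrite ?mulr0.
move=> i ki.
case tmu: (ty mu k).
all: try by rewrite (sources_single _ _ amu) ?tmu ?imset_set1.
all: try by rewrite (sources_type2_real _ amu) ?tmu ?imsetU1 ?imset_set1.
by rewrite (sources_2r21 tmu ki amu).
Qed.
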